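(* Let $X$ and $Y$ be generalized ordered sets. Then the cartesian product $X\times Y$, equipped with the lexicographic order, is a generalized ordered set.
   Context: The setting is constructive mathematics: no use of the law of excluded middle. For a set $X$ with a binary relation $<$, write $x\leq_{P}y$ if for all $z\in X$, $z<x$ implies $z<y$, and $y<z$ implies $x<z$. A generalized ordered set is a set $X$ with a binary relation $<$ such that for all $x,y,z\in X$: (asymmetry) $x<y$ implies $\neg(y<x)$; (transitivity) $x<y$ and $y<z$ imply $x<z$; (positive antisymmetry) $x\leq_{P}y$ and $y\leq_{P}x$ imply $x=y$. The cartesian product $X\times Y$ has equality $(x,y)=(x',y')$ iff $x=x'$ and $y=y'$. The lexicographic order is $(x,y)<(x',y')$ iff $x<x'$, or ($x=x'$ and $y<y'$). *)

(* Defs.v *)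
From Stdlib Require Export RelationClasses Morphisms Relation_Definitions RelationPairs.

Set Implicit Arguments.

Definition leP (X : Type) (lt : relation X) (x y : X) : Prop :=
  forall z : X, (lt z x -> lt z y) /\ (lt y z -> lt x z).

(* A constructive set is a type with an explicit equality [eqX], an equivalence
   relation; a relation on it is required to respect that equality. *)
Record generalized_ordered_set (X : Type) (eqX lt : relation X) : Prop := {
  gos_equivalence : Equivalence eqX;
  gos_extensional : Proper (eqX ==> eqX ==> iff) lt;
  gos_asymmetric : forall x y : X, lt x y -> ~ lt y x;
  gos_transitive : forall x y z : X, lt x y -> lt y z -> lt x z;
  gos_positive_antisymmetric :
    forall x y : X, leP lt x y -> leP lt y x -> eqX x y
}.

Definition lexicographic (X Y : Type) (eqX ltX : relation X) (ltY : relation Y)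
    : relation (X * Y) :=
  fun p q => ltX (fst p) (fst q) \/ (eqX (fst p) (fst q) /\ ltY (snd p) (snd q)).

(* Main.v *)
(** Suppose [(x, y) <=_P (x', y')]. If [z < x] then [(z, y') < (x, y)], hence
    [(z, y') < (x', y')]; the alternative [z = x'], [y' < y'] is absurd, so
    [z < x']. Dually [x' < z] yields [x < z], so [x <=_P x']. Once [x = x'] is
    known, comparing [(x, y)] with the pairs [(x, z)] gives [y <=_P y']. *)

Require Import Defs.
From Stdlib Require Import Setoid Morphisms_Prop.

Lemma gos_irreflexive {X : Type} {eqX ltX : relation X}
    (hX : generalized_ordered_set eqX ltX) (x : X) : ~ ltX x x.
Proof. intros h; exact (gos_asymmetric hX _ _ h h). Qed.

(** Extensionality turns [ltX x y] into an instance of irreflexivity. This refutes every case below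
    in which two first coordinates are both equal and strictly related. *)
Lemma gos_eq_not_lt {X : Type} {eqX ltX : relation X}
    (hX : generalized_ordered_set eqX ltX) (x y : X) : eqX x y -> ~ ltX x y.
Proof.
  intros e h. pose proof (gos_equivalence hX). pose proof (gos_extensional hX).
  rewrite e in h. exact (gos_irreflexive hX _ h).
Qed.

Section Lexicographic.

Variables (X Y : Type) (eqX ltX : relation X) (eqY ltY : relation Y).
Hypothesis hX : generalized_ordered_set eqX ltX.
Hypothesis hY : generalized_ordered_set eqY ltY.

#[local] Instance eqX_equivalence : Equivalence eqX := gos_equivalence hX.
#[local] Instance eqY_equivalence : Equivalence eqY := gos_equivalence hY.
#[local] Instance ltX_proper : Proper (eqX ==> eqX ==> iff) ltX :=
  gos_extensional hX.
#[local] Instance ltY_proper : Proper (eqY ==> eqY ==> iff) ltY :=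
  gos_extensional hY.

Local Notation lex := (lexicographic eqX ltX ltY).

Lemma lexicographic_proper :
  Proper (RelProd eqX eqY ==> RelProd eqX eqY ==> iff) lex.
Proof.
  intros [a b] [a' b'] [ea eb] [c d] [c' d'] [ec ed].
  unfold RelCompFun in *; unfold lexicographic; simpl in *.
  rewrite ea, eb, ec, ed; reflexivity.
Qed.

Lemma lexicographic_asymmetric (p q : X * Y) : lex p q -> ~ lex q p.
Proof.
  intros [h | [e h]] [k | [f k]].
  - exact (gos_asymmetric hX _ _ h k).
  - symmetry in f; exact (gos_eq_not_lt hX _ _ f h).
  - symmetry in e; exact (gos_eq_not_lt hX _ _ e k).
  - exact (gos_asymmetric hY _ _ h k).
Qed.

(** A strict step in one pair of first coordinates survives transport along an equality in the
    other; two equalities leave transitivity in [Y]. *)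
Lemma lexicographic_transitive (p q r : X * Y) : lex p q -> lex q r -> lex p r.
Proof.
  unfold lexicographic; intros [h | [e h]] [k | [f k]].
  - left; exact (gos_transitive hX _ _ _ h k).
  - left; rewrite <- f; exact h.
  - left; rewrite e; exact k.
  - right; split; [now rewrite e | exact (gos_transitive hY _ _ _ h k)].
Qed.

Lemma leP_lexicographic_fst (p q : X * Y) :
  leP lex p q -> leP ltX (fst p) (fst q).
Proof.
  intros h z; split; intros hz.
  - destruct (proj1 (h (z, snd q)) (or_introl hz)) as [k | [_ k]];
      [exact k | destruct (gos_irreflexive hY _ k)].
  (* The dual test pair carries [snd p], since its conclusion compares it with [p]: a tie would give
     [snd p] below itself. *)
  - destruct (proj2 (h (z, snd p)) (or_introl hz)) as [k | [_ k]];
      [exact k | destruct (gos_irreflexive hY _ k)].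
Qed.

Lemma leP_lexicographic_snd (p q : X * Y) :
  eqX (fst p) (fst q) -> leP lex p q -> leP ltY (snd p) (snd q).
Proof.
  intros e h z; split; intros hz.
  (* The test pair ties with [p] in the first coordinate; [e] then excludes a strict
     first-coordinate comparison with [q], leaving the one in [Y]. *)
  - assert (l : lex (fst p, z) p) by (right; split; [reflexivity | exact hz]).
    destruct (proj1 (h _) l) as [k | [_ k]];
      [destruct (gos_eq_not_lt hX _ _ e k) | exact k].
  - assert (l : lex q (fst q, z)) by (right; split; [reflexivity | exact hz]).
    destruct (proj2 (h _) l) as [k | [_ k]];
      [destruct (gos_eq_not_lt hX _ _ e k) | exact k].
Qed.

Lemma lexicographic_positive_antisymmetric (p q : X * Y) :
  leP lex p q -> leP lex q p -> RelProd eqX eqY p q.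
Proof.
  intros h k.
  (* Both inequalities are spent on [X] first, because comparing second coordinates presupposes this
     equality. *)
  assert (e : eqX (fst p) (fst q))
    by (apply (gos_positive_antisymmetric hX); now apply leP_lexicographic_fst).
  split; [exact e |].
  apply (gos_positive_antisymmetric hY); apply leP_lexicographic_snd; auto.
  now symmetry.
Qed.

End Lexicographic.

Theorem theorem19 (X Y : Type) (eqX ltX : relation X) (eqY ltY : relation Y)
    (hX : generalized_ordered_set eqX ltX)
    (hY : generalized_ordered_set eqY ltY) :
  generalized_ordered_set (RelProd eqX eqY) (lexicographic eqX ltX ltY).
Proof.
  split.
  - pose proof (gos_equivalence hX); pose proof (gos_equivalence hY).
    typeclasses eauto.
  - exact (lexicographic_proper _ _ _ _ _ _ hX hY).
  - exact (lexicographic_asymmetric _ _ _ _ _ _ hX hY).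
  - exact (lexicographic_transitive _ _ _ _ _ _ hX hY).
  - exact (lexicographic_positive_antisymmetric _ _ _ _ _ _ hX hY).
Qed.
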